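(* Let $g:(0,\infty)\times(0,\infty)\to\mathbb{R}$ satisfy $g(s,t)=-g(t,s)$ and $g(\alpha s,\alpha t)=g(s,t)$ for all $s,t,\alpha>0$. Let $V\in\mathrm{Sym}^{++}(3)$ have eigenvalues $\lambda_1,\lambda_2,\lambda_3>0$ (listed with multiplicity), let $B=V^2$, and let $\mathbb{A}^{\circ}(B):\mathrm{Sym}(3)\to\mathrm{Sym}(3)$ be the stiffness tensor of the corotational rate with the material spin generated by $g$, i.e. $$\mathbb{A}^{\circ}(B).D = B D + D B+\sum_{\substack{\mu,\nu\in\mathrm{spec}(V)\\ \mu\neq\nu}} g(\mu,\nu)\,(\mu^2-\nu^2)\,P_\mu\, D\, P_\nu ,$$ where $\mathrm{spec}(V)$ is the set of distinct eigenvalues of $V$ and $P_\mu$ is the orthogonal projection onto the eigenspace of $V$ for $\mu$. Set $$z_{ij}:=\lambda_i^2+\lambda_j^2+g(\lambda_i,\lambda_j)\,(\lambda_i^2-\lambda_j^2),\qquad i,j=1,2,3 .$$ Then: (i) $\langle \mathbb{A}^{\circ}(B).D,D\rangle>0$ for all $D\in\mathrm{Sym}(3)\setminus\{0\}$ if and only if $z_{ij}>0$ for all $i,j\in\{1,2,3\}$; (ii) $\mathbb{A}^{\circ}(B)$ is invertible if and only if $z_{ij}\neq 0$ for all $i,j\in\{1,2,3\}$.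
   Context: $\mathrm{Sym}(3)$ denotes the real symmetric $3\times3$ matrices, $\mathrm{Sym}^{++}(3)$ the positive definite ones, $\langle X,Y\rangle=\mathrm{tr}(XY^T)$. In the mechanical setting, $F$ is the deformation gradient of a motion, $B=FF^T=V^2$ with $V\in\mathrm{Sym}^{++}(3)$ the left stretch tensor, $L=\dot F F^{-1}$, $D=\frac12(L+L^T)$, $W=\frac12(L-L^T)$. The corotational rate with skew-symmetric spin $\Omega^{\circ}$ is $\frac{\mathrm{D}^{\circ}}{\mathrm{D}t}[B]=\frac{\mathrm{D}}{\mathrm{D}t}[B]-\Omega^{\circ}B+B\Omega^{\circ}$, and the material spin generated by $g$ is $\Omega^{\circ}=W+\sum_{\mu\neq\nu}g(\mu,\nu)P_\mu D P_\nu$ (sum over distinct eigenvalues of $V$); then $\frac{\mathrm{D}^{\circ}}{\mathrm{D}t}[B]=\mathbb{A}^{\circ}(B).D$ with $\mathbb{A}^{\circ}(B)$ as displayed in the claim. The sum is zero if $V$ has only one distinct eigenvalue. *)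

(* Defs.v *)
From HB Require Import structures.
From mathcomp Require Import all_boot all_order all_algebra.
From mathcomp Require Import mathcomp_extra boolp classical_sets functions.
From mathcomp Require Import cardinality fsbigop reals.

Set Implicit Arguments.
Unset Strict Implicit.
Unset Printing Implicit Defensive.

Import GRing.Theory Num.Theory.
Local Open Scope classical_set_scope.
Local Open Scope ring_scope.

Section Definitions.
Variables (R : realType) (n : nat).
Implicit Types (V D X Y : 'M[R]_n) (g : R -> R -> R).

Definition Sym : set 'M[R]_n := [set D | D \is symmetricmx].

Definition posdefmx V : Prop :=
  V \is symmetricmx /\ forall x : 'cV[R]_n, x != 0 -> 0 < (x^T *m V *m x) 0 0.

Definition inner X Y : R := \tr (X *m Y^T).

(* The library's [eigenspace V mu] is a square matrix whose rows span
   {u : 'rV_n | u *m V = mu *: u}, and [kermx E^T] has as row space the set of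
   row vectors orthogonal to all rows of E.  [proj_mx] projects row vectors
   (u |-> u *m P).  For symmetric V the left and right eigenvectors correspond
   by transposition and the orthogonal projection is a symmetric matrix, so
   this is also the matrix of the projection acting on column vectors. *)
Definition eigenproj V (mu : R) : 'M[R]_n :=
  let E := eigenspace V mu in proj_mx E (kermx E^T).

(* The sum is the finitely supported big operator over a classical set, here
   the ordered pairs of distinct eigenvalues of V; that set is finite, and the
   sum is 0 when it is empty. *)
Definition stiffness g V D : 'M[R]_n :=
  let B := V *m V in
  B *m D + D *m B
  + \sum_(p \in [set p : R * R | [/\ eigenvalue V p.1, eigenvalue V p.2
                                   & p.1 != p.2]])
      (g p.1 p.2 * (p.1 ^+ 2 - p.2 ^+ 2))
        *: (eigenproj V p.1 *m D *m eigenproj V p.2).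

Definition zcoef g (lambda : 'I_n -> R) (i j : 'I_n) : R :=
  lambda i ^+ 2 + lambda j ^+ 2
  + g (lambda i) (lambda j) * (lambda i ^+ 2 - lambda j ^+ 2).

End Definitions.
Arguments Sym : clear implicits.

(* Main.v *)
Require Import Defs.
From HB Require Import structures.
From mathcomp Require Import all_boot all_order all_algebra.
From mathcomp Require Import mathcomp_extra boolp classical_sets functions.
From mathcomp Require Import cardinality fsbigop reals.

Set Implicit Arguments.
Unset Strict Implicit.
Unset Printing Implicit Defensive.

Import Order.TTheory GRing.Theory Num.Theory.
Local Open Scope classical_set_scope.
Local Open Scope ring_scope.

(** The point is that the stiffness tensor is diagonal with respect to the
    spectral resolution of [V].  Since the orthogonal eigenprojections [P_a]
    sum to 1 and [V = sum_a a P_a], the terms [B D + D B] are also double sums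
    of blocks [P_a D P_b], and [stiffness_spectral] gives
      [stiffness g V D = sum_(a, b) z(a, b) P_a D P_b],
    with [z(a, b) = a^2 + b^2 + g(a, b) (a^2 - b^2)], over all pairs of
    eigenvalues, equal or not.  Antisymmetry of [g] at the (positive)
    eigenvalues makes [z] symmetric.

    The theorem is then a statement about such Schur multipliers
    ([spectral_mult]): they compose by multiplying their symbols, and the
    blocks [P_a D P_b] are mutually orthogonal, so the quadratic form is
    [sum z(a, b) |P_a D P_b|^2].  Thus nonzero (resp. positive) symbols give an
    invertible (resp. positive definite) operator.  Conversely, for
    eigenvectors [x] and [y] at [a] and [b], the symmetrized dyad
    [x^T y + y^T x] is a nonzero symmetric eigenvector of the operator with
    eigenvalue [z(a, b)] ([spectral_mult_eigenvector]).

    That the eigenprojections sum to 1 comes from [symmetric_sum_eigenspace]: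
    the characteristic polynomial is given as a product of real linear
    factors, and a symmetric matrix has no nilpotent part. *)

(** * Real symmetric matrices *)

Lemma symmetricmxP (R : realType) n (D : 'M[R]_n) :
  reflect (D^T = D) (D \is symmetricmx).
Proof.
apply: (iffP (is_hermitianmxP _ _ _)); rewrite expr0 scale1r map_mx_id //.
Qed.

Lemma inner_ge0 (R : realType) m n (X : 'M[R]_(m, n)) : 0 <= \tr (X *m X^T).
Proof.
apply: sumr_ge0 => i _; rewrite mxE; apply: sumr_ge0 => j _.
by rewrite mxE -expr2 sqr_ge0.
Qed.

Lemma inner_eq0 (R : realType) m n (X : 'M[R]_(m, n)) :
  \tr (X *m X^T) = 0 -> X = 0.
Proof.
have sq_ge0 i j : 0 <= X i j * X^T j i by rewrite mxE -expr2 sqr_ge0.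
have row_ge0 i : 0 <= (X *m X^T) i i by rewrite mxE sumr_ge0.
move/eqP; rewrite psumr_eq0 // => /allP trX0; apply/matrixP => i j.
have /eqP := trX0 i (mem_index_enum i).
move/eqP; rewrite /= mxE psumr_eq0 // => /allP/(_ j (mem_index_enum j)).
by rewrite !mxE /= mulf_eq0 orbb => /eqP.
Qed.

Lemma inner_gt0 (R : realType) m n (X : 'M[R]_(m, n)) :
  X != 0 -> 0 < \tr (X *m X^T).
Proof.
by move=> X0; rewrite lt0r inner_ge0 andbT; apply: contra X0 => /eqP/inner_eq0 ->.
Qed.

Lemma mulmx_tr_eq0 (R : realType) m n (X : 'M[R]_(m, n)) :
  X *m X^T = 0 -> X = 0.
Proof. by move=> X0; apply: inner_eq0; rewrite X0 mxtrace0. Qed.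

Lemma trmx_horner (R : comNzRingType) n (A : 'M[R]_n.+1) (p : {poly R}) :
  A^T = A -> (horner_mx A p)^T = horner_mx A p.
Proof.
move=> At; elim/poly_ind: p => [|p c IHp]; first by rewrite rmorph0 trmx0.
rewrite rmorphD linearD /= horner_mx_C tr_scalar_mx; congr (_ + _).
by rewrite {2}mulrC !rmorphM /= horner_mx_X trmx_mul IHp At.
Qed.

(** If [M] is symmetric then [M ^+ 2 = M M^T], which vanishes only with [M]; the
    exponent is raised to a power of 2 and then halved repeatedly. *)
Lemma symmetric_nilpotent (R : realType) n (N : 'M[R]_n.+1) k :
  N^T = N -> N ^+ k = 0 -> N = 0.
Proof.
move=> Nt Nk0; have {Nk0}: N ^+ (2 ^ k)%N = 0.
  by rewrite -(subnK (ltnW (ltn_expl k (ltnSn 1)))) exprD Nk0 mulr0.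
elim: k => [//|k IHk]; rewrite expnSr exprM => Nk0; apply: IHk.
apply: mulmx_tr_eq0.
by rewrite -{2}[N]horner_mx_X -rmorphXn trmx_horner //= rmorphXn /= horner_mx_X.
Qed.

(** Cayley-Hamilton makes [q(V)] nilpotent, where [q] is the squarefree
    polynomial with the roots [rs].  As [q(V)] is symmetric it is zero, and the
    kernel of [q(V)] is the sum of the eigenspaces. *)
Lemma symmetric_sum_eigenspace (R : realType) n (V : 'M[R]_n.+1) m
    (lambda : 'I_m -> R) (rs : seq R) :
    V^T = V -> char_poly V = \prod_(i < m) ('X - (lambda i)%:P) ->
    uniq rs -> (forall i, lambda i \in rs) ->
  (\sum_(r <- rs) eigenspace V r :=: 1%:M)%MS.
Proof.
move=> Vt charV rs_uniq rsP.
pose q := \prod_(r <- rs) ('X - r%:P).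
have qV0 : horner_mx V q = 0.
  apply: (@symmetric_nilpotent _ _ _ m); first exact: trmx_horner.
  have /dvdpP[c qE] : char_poly V %| q ^+ m.
    rewrite charV -[m in q ^+ m]card_ord -prodr_const.
    apply: (big_ind2 (fun x y => x %| y)) => [//|*|i _]; first exact: dvdp_mul.
    by rewrite dvdp_XsubCl root_prod_XsubC.
  by rewrite -rmorphXn /= qE rmorphM /= Cayley_Hamilton mulr0.
have := kermxpoly_min (mxminpoly_min qV0).
rewrite /q (big_nth 0) big_mkord => kerq.
rewrite (big_nth 0) big_mkord (eq_bigr _ (fun _ _ => eigenspace_poly _ _)).
apply: (eqmx_trans (eqmx_sym (kermxpoly_prod _ _)) _) => //.
by move=> i j _ _; rewrite coprimep_XsubC root_XsubC nth_uniq.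
Qed.

(** * Orthogonal projections onto eigenspaces *)

(** This and the next lemma say that the two subspaces defining [eigenproj] are
    complementary, without which [proj_mx] is not a projection. *)
Lemma cap_orthogonal (R : realType) n (E : 'M[R]_n) : (E :&: kermx E^T = 0)%MS.
Proof.
apply/eqP/rowV0P => u; rewrite sub_capmx => /andP[/submxP[w uE] /sub_kermxP uEt].
by apply: mulmx_tr_eq0; rewrite {2}uE trmx_mul mulmxA uEt mul0mx.
Qed.

Lemma add_orthogonal (R : realType) n (E : 'M[R]_n) :
  (E + kermx E^T :=: 1%:M)%MS.
Proof.
apply/eqmxP; rewrite submx1 sub1mx /row_full.
rewrite mxrank_disjoint_sum ?cap_orthogonal // mxrank_ker mxrank_tr.
by apply/eqP; apply: subnKC; apply: rank_leq_col.
Qed.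

Section EigenProjections.
Variables (R : realType) (n : nat) (V : 'M[R]_n).
Hypothesis Vt : V^T = V.

Lemma eigenproj_id m (W : 'M[R]_(m, n)) a :
  W *m V = a *: W -> W *m eigenproj V a = W.
Proof. by move=> /eigenspaceP WV; rewrite proj_mx_id ?cap_orthogonal. Qed.

(** Row eigenspaces of a symmetric matrix for distinct eigenvalues are
    orthogonal, so [W] lies in the kernel of the projection. *)
Lemma eigenproj_neq m (W : 'M[R]_(m, n)) a b :
  W *m V = b *: W -> a != b -> W *m eigenproj V a = 0.
Proof.
move=> WV ab; rewrite proj_mx_0 ?cap_orthogonal //; apply/sub_kermxP.
set E := eigenspace V a.
have EV : V *m E^T = a *: E^T.
  by rewrite -{1}Vt -trmx_mul (eigenspaceP (submx_refl E)) linearZ.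
have /eqP : b *: (W *m E^T) = a *: (W *m E^T).
  by rewrite scalemxAl -WV -mulmxA EV scalemxAr.
by rewrite -subr_eq0 -scalerBl scaler_eq0 subr_eq0 eq_sym (negPf ab) => /eqP.
Qed.

Lemma eigenproj_mulV a : eigenproj V a *m V = a *: eigenproj V a.
Proof.
by apply/eigenspaceP; rewrite -[eigenproj V a]mul1mx proj_mx_sub.
Qed.

(** The rows of [P] and of [1 - P] span orthogonal spaces, hence
    [P (1 - P)^T = 0] and [P = P P^T]. *)
Lemma tr_eigenproj a : (eigenproj V a)^T = eigenproj V a.
Proof.
set P := eigenproj V a; set E := eigenspace V a.
have /submxP[w PE] : (P <= E)%MS by rewrite -[P]mul1mx proj_mx_sub.
have orth : E *m (1%:M - P)^T = 0.
  have /sub_kermxP PE0 : (1%:M - P <= kermx E^T)%MS.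
    by rewrite -{1}[P]mul1mx proj_mx_compl_sub // add_orthogonal.
  by rewrite -[E]trmxK -trmx_mul PE0 trmx0.
have PPt : P = P *m P^T.
  apply/eqP; rewrite -subr_eq0 -{1}[P]mulmx1 -mulmxBr.
  have -> : 1%:M - P^T = (1%:M - P)^T by rewrite linearB /= tr_scalar_mx.
  by rewrite {1}PE -mulmxA orth mulmx0.
by rewrite PPt trmx_mul trmxK.
Qed.

Lemma mulV_eigenproj a : V *m eigenproj V a = a *: eigenproj V a.
Proof.
rewrite -{1}Vt -{1}tr_eigenproj -trmx_mul eigenproj_mulV linearZ /=.
by rewrite tr_eigenproj.
Qed.

Lemma mul_eigenproj a b :
  eigenproj V a *m eigenproj V b = if a == b then eigenproj V a else 0.
Proof.
case: eqVneq => [<-|ab]; first by rewrite eigenproj_id ?eigenproj_mulV.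
by rewrite (eigenproj_neq (eigenproj_mulV a)) // eq_sym.
Qed.

Lemma sum_eigenproj (rs : seq R) :
  uniq rs -> (\sum_(r <- rs) eigenspace V r :=: 1%:M)%MS ->
  \sum_(r <- rs) eigenproj V r = 1%:M.
Proof.
move=> rs_uniq rs1; set S := \sum_(r <- rs) _.
have : (1%:M <= kermx (S - 1%:M))%MS.
  rewrite -rs1 big_seq.
  apply/(big_ind (fun A => A <= kermx (S - 1%:M))%MS).
  - exact: sub0mx.
  - by move=> A B sA sB; rewrite addsmx_sub sA sB.
  move=> a ars; apply/sub_kermxP; rewrite mulmxBr mulmx1.
  have EV := eigenspaceP (submx_refl (eigenspace V a)).
  rewrite mulmx_sumr (bigD1_seq a) //= eigenproj_id // big1 ?addr0 ?subrr //.
  by move=> b ba; apply: (eigenproj_neq EV).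
by move/sub_kermxP; rewrite mul1mx => /eqP; rewrite subr_eq0 => /eqP.
Qed.

Lemma eigenproj_neq0 a : eigenvalue V a -> eigenproj V a != 0.
Proof.
move=> /eigenvalueP[x xV x0]; apply: contra x0 => /eqP P0.
by rewrite -(eigenproj_id xV) P0 mulmx0.
Qed.

End EigenProjections.

(** * Spectral multipliers *)

(** In a basis adapted to the ranges of the [P a], this is entrywise (Schur)
    multiplication of [D] by the values of the symbol [f]. *)
Definition spectral_mult (R : realType) n (P : R -> 'M[R]_n) (rs : seq R)
    (f : R -> R -> R) (D : 'M[R]_n) : 'M[R]_n :=
  \sum_(a <- rs) \sum_(b <- rs) f a b *: (P a *m D *m P b).

Section SpectralMultipliers.
Variables (R : realType) (n : nat) (P : R -> 'M[R]_n) (rs : seq R).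
Hypothesis rs_uniq : uniq rs.
Hypothesis trP : forall a, (P a)^T = P a.
Hypothesis mulP : forall a b, P a *m P b = if a == b then P a else 0.
Hypothesis sumP : \sum_(r <- rs) P r = 1%:M.
Implicit Types (f h : R -> R -> R) (D : 'M[R]_n).

Notation T := (spectral_mult P rs).

Lemma eq_spectral_mult f h D :
  {in rs &, forall a b, f a b = h a b} -> T f D = T h D.
Proof.
move=> fh; apply: eq_big_seq => a ars; apply: eq_big_seq => b brs.
by rewrite fh.
Qed.

Lemma spectral_multD f h D : T (fun a b => f a b + h a b) D = T f D + T h D.
Proof.
rewrite -big_split; apply: eq_bigr => a _; rewrite -big_split.
by apply: eq_bigr => b _; rewrite scalerDl.
Qed.

Lemma spectral_mult_factor (u v : R -> R) D :
  T (fun a b => u a * v b) D =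
  (\sum_(a <- rs) u a *: P a) *m D *m (\sum_(b <- rs) v b *: P b).
Proof.
rewrite mulmx_suml mulmx_suml; apply: eq_bigr => a _.
rewrite mulmx_sumr; apply: eq_bigr => b _.
by rewrite -scalemxAr -!scalemxAl scalerA mulrC.
Qed.

Lemma spectral_mult1 D : T (fun _ _ => 1) D = D.
Proof.
have -> : T (fun _ _ => 1) D = T (fun a b => (fun=> 1) a * (fun=> 1) b) D.
  by apply: eq_spectral_mult => a b _ _; rewrite mulr1.
rewrite spectral_mult_factor; under eq_bigr do rewrite scale1r.
by rewrite sumP mul1mx mulmx1.
Qed.

Lemma eigenproj_spectral_mult f D : {in rs &, forall a b,
  P a *m T f D *m P b = f a b *: (P a *m D *m P b)}.
Proof.
move=> a b ars brs; rewrite mulmx_sumr mulmx_suml (bigD1_seq a) //=.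
rewrite [X in _ + X]big1 ?addr0 => [|c ca]; last first.
  rewrite mulmx_sumr mulmx_suml big1 // => d _.
  rewrite -scalemxAr -scalemxAl !mulmxA mulP eq_sym (negPf ca).
  by rewrite !mul0mx scaler0.
rewrite mulmx_sumr mulmx_suml (bigD1_seq b) //=.
rewrite big1 ?addr0 => [|d db]; last first.
  by rewrite -scalemxAr -scalemxAl -!mulmxA mulP (negPf db)
             !mulmx0 scaler0.
rewrite -scalemxAr -scalemxAl !mulmxA mulP eqxx.
by rewrite -!mulmxA mulP eqxx.
Qed.

Lemma spectral_multM f h D : T f (T h D) = T (fun a b => f a b * h a b) D.
Proof.
apply: eq_big_seq => a ars; apply: eq_big_seq => b brs.
by rewrite eigenproj_spectral_mult // scalerA.
Qed.

Lemma spectral_mult_add f D E : T f (D + E) = T f D + T f E.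
Proof.
rewrite -big_split; apply: eq_bigr => a _; rewrite -big_split.
by apply: eq_bigr => b _; rewrite mulmxDr mulmxDl scalerDr.
Qed.

Lemma tr_spectral_mult f D :
  {in rs &, forall a b, f a b = f b a} -> D^T = D -> (T f D)^T = T f D.
Proof.
move=> fC Dt; rewrite raddf_sum; under eq_bigr do rewrite raddf_sum.
rewrite exchange_big; apply: eq_big_seq => a ars; apply: eq_big_seq => b brs.
by rewrite /= linearZ /= !trmx_mul !trP Dt mulmxA fC.
Qed.

(** The blocks [P a D P b] are pairwise orthogonal for the Frobenius product, so
    there are no cross terms. *)
Lemma inner_spectral_mult f D : inner (T f D) D =
  \sum_(a <- rs) \sum_(b <- rs)
     f a b * \tr ((P a *m D *m P b) *m (P a *m D *m P b)^T).
Proof.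
rewrite /inner mulmx_suml raddf_sum; apply: eq_bigr => a _.
rewrite mulmx_suml raddf_sum; apply: eq_bigr => b _ /=.
rewrite -scalemxAl mxtraceZ; congr (_ * _).
rewrite !trmx_mul !trP !mulmxA [RHS]mxtrace_mulC !mulmxA.
by rewrite mulP eqxx -!mulmxA (mulmxA (P b)) mulP eqxx.
Qed.

Lemma spectral_mult_dyad f (x y : 'rV[R]_n) a b : a \in rs -> b \in rs ->
  x *m P a = x -> y *m P b = y -> T f (x^T *m y) = f a b *: (x^T *m y).
Proof.
move=> ars brs xP yP.
have Px c : P c *m x^T = (x *m P c)^T by rewrite trmx_mul trP.
rewrite /spectral_mult (bigD1_seq a) //=.
rewrite [X in _ + X]big1 ?addr0 => [|c ca]; last first.
  rewrite big1 // => d _; rewrite !mulmxA Px -xP -(mulmxA x) mulP.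
  by rewrite eq_sym (negPf ca) mulmx0 trmx0 !mul0mx scaler0.
rewrite (bigD1_seq b) //= big1 ?addr0 => [|d db]; last first.
  by rewrite -yP -!mulmxA mulP eq_sym (negPf db) !mulmx0 scaler0.
by rewrite mulmxA Px -mulmxA xP yP.
Qed.

Hypothesis P_neq0 : {in rs, forall a, P a != 0}.

(** Every value of a symmetric symbol is an eigenvalue of the operator on
    symmetric matrices; the eigenvector can be chosen independently of [f]. *)
Lemma spectral_mult_eigenvector a b : a \in rs -> b \in rs ->
  exists D, [/\ D^T = D, D != 0 &
    forall f, f a b = f b a -> T f D = f a b *: D].
Proof.
move=> ars brs.
have range_vec c : c \in rs -> exists2 x : 'rV_n, x *m P c = x & x != 0.
  move=> /P_neq0/rowV0Pn[_ /submxP[w ->] w0].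
  by exists (w *m P c); rewrite // -mulmxA mulP eqxx.
have [[x xP x0] [y yP y0]] := (range_vec a ars, range_vec b brs).
exists (x^T *m y + y^T *m x); split.
- by rewrite linearD /= !trmx_mul !trmxK addrC.
- apply/eqP => D0.
  (* The value of the form at (x, y) is |x|^2 |y|^2 + (x . y)^2; this argument
     covers a = b, where x and y need not be orthogonal or distinct. *)
  have : x *m (x^T *m y + y^T *m x) *m y^T = 0 by rewrite D0 mulmx0 mul0mx.
  rewrite mulmxDr mulmxDl !mulmxA -2!(mulmxA (_ *m _)).
  have -> : x *m y^T = (y *m x^T)^T by rewrite trmx_mul trmxK.
  rewrite [x *m x^T]mx11_scalar [y *m y^T]mx11_scalar [y *m x^T]mx11_scalar.
  rewrite tr_scalar_mx -!scalar_mxM -raddfD /= => /(congr1 mxtrace).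
  rewrite mxtrace0 mxtrace_scalar mulr1n -!trace_mx11 -expr2; apply/eqP.
  by rewrite gt_eqF // ltr_wpDr ?sqr_ge0 // mulr_gt0 ?inner_gt0.
move=> f fab; rewrite spectral_mult_add (spectral_mult_dyad _ ars brs) //.
by rewrite (spectral_mult_dyad _ brs ars) // -fab scalerDr.
Qed.

Lemma spectral_mult_posdef f : {in rs &, forall a b, f a b = f b a} ->
  (forall D, D \is symmetricmx -> D != 0 -> 0 < inner (T f D) D) <->
  {in rs &, forall a b, 0 < f a b}.
Proof.
move=> fC; split=> [Tpos a b ars brs | fpos D _ D0].
  have [D [Dt D0 TD]] := spectral_mult_eigenvector ars brs.
  have := Tpos D (introT (symmetricmxP D) Dt) D0.
  rewrite (TD f (fC a b ars brs)) /inner -scalemxAl mxtraceZ.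
  by rewrite pmulr_lgt0 // inner_gt0.
have term_ge0 a b : a \in rs -> b \in rs ->
    0 <= f a b * \tr ((P a *m D *m P b) *m (P a *m D *m P b)^T).
  by move=> ars brs; rewrite mulr_ge0 ?inner_ge0 // ltW ?fpos.
have row_ge0 a : a \in rs -> 0 <= \sum_(b <- rs)
    f a b * \tr ((P a *m D *m P b) *m (P a *m D *m P b)^T).
  by move=> ars; rewrite big_seq sumr_ge0 // => b; apply: term_ge0.
rewrite inner_spectral_mult lt0r; apply/andP; split; last first.
  by rewrite big_seq sumr_ge0.
apply: contra D0; rewrite big_seq psumr_eq0 // => /allP rows0.
rewrite -[D]spectral_mult1 /spectral_mult big_seq big1 // => a ars.
have := rows0 a ars; rewrite ars /= big_seq psumr_eq0; last first.
  by move=> b brs; apply: term_ge0.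
move=> /allP terms0; rewrite big_seq big1 // => b brs.
have := terms0 b brs; rewrite brs /= mulf_eq0 gt_eqF ?fpos //=.
by move=> /eqP/inner_eq0 ->; rewrite scaler0.
Qed.

Lemma spectral_mult_bij f : {in rs &, forall a b, f a b = f b a} ->
  set_bij (Sym R n) (Sym R n) (T f) <-> {in rs &, forall a b, f a b != 0}.
Proof.
move=> fC; split=> [[_ Tinj _] a b ars brs | f0].
  have [D [Dt D0 TD]] := spectral_mult_eigenvector ars brs.
  have T0 : T f 0 = 0.
    by apply: (addrI (T f 0)); rewrite -spectral_mult_add !addr0.
  apply: contra D0 => /eqP fab0; apply/eqP/Tinj.
  - by rewrite inE; apply/symmetricmxP.
  - by rewrite inE; apply/symmetricmxP; rewrite trmx0.
  by rewrite (TD f (fC a b ars brs)) fab0 scale0r T0.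
pose h a b := (f a b)^-1.
have hC : {in rs &, forall a b, h a b = h b a}.
  by move=> a b ars brs; rewrite /h (fC a b).
have hfK D : T h (T f D) = D.
  rewrite spectral_multM -[RHS]spectral_mult1; apply: eq_spectral_mult.
  by move=> a b ars brs; rewrite mulVf ?f0.
have fhK D : T f (T h D) = D.
  rewrite spectral_multM -[RHS]spectral_mult1; apply: eq_spectral_mult.
  by move=> a b ars brs; rewrite mulfV ?f0.
split.
- by move=> D /symmetricmxP Dt; apply/symmetricmxP; rewrite tr_spectral_mult.
- by move=> D E _ _ /(congr1 (T h)); rewrite !hfK.
move=> D /symmetricmxP Dt; exists (T h D); last exact: fhK.
by apply/symmetricmxP; rewrite tr_spectral_mult.
Qed.

End SpectralMultipliers.

(** * The stiffness tensor *)

(** [zcoef] as a function of a pair of eigenvalues instead of a pair of indices,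
    so that it can index the projections, of which there is one for each
    distinct eigenvalue. *)
Definition stiffness_symbol (R : realType) (g : R -> R -> R) (a b : R) : R :=
  a ^+ 2 + b ^+ 2 + g a b * (a ^+ 2 - b ^+ 2).

(** Left multiplication by [B] has symbol [a^2], right multiplication [b^2], and
    the finitely supported sum is a sum over pairs of entries of [rs]. *)
Lemma stiffness_spectral (R : realType) n (g : R -> R -> R) (V : 'M[R]_n)
    (rs : seq R) (D : 'M[R]_n) :
    V^T = V -> uniq rs -> rs =i eigenvalue V ->
    \sum_(r <- rs) eigenproj V r = 1%:M ->
  stiffness g V D = spectral_mult (eigenproj V) rs (stiffness_symbol g) D.
Proof.
move=> Vt rs_uniq rsE rs1.
have rs_eig a : a \in rs -> eigenvalue V a by rewrite rsE.
have VE : V *m V = \sum_(a <- rs) a ^+ 2 *: eigenproj V a.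
  rewrite -[LHS]mulmx1 -rs1 mulmx_sumr; apply: eq_bigr => a _.
  by rewrite -mulmxA mulV_eigenproj // -scalemxAr mulV_eigenproj // scalerA.
have E1 : 1%:M = \sum_(a <- rs) 1 *: eigenproj V a.
  by under eq_bigr do rewrite scale1r.
rewrite /stiffness /stiffness_symbol !spectral_multD; congr (_ + _ + _).
- rewrite -[LHS]mulmx1 VE E1 -(spectral_mult_factor _ _ (fun a => a ^+ 2)).
  by apply: eq_spectral_mult => a b _ _; rewrite mulr1.
- rewrite -[D *m _]mul1mx mulmxA VE E1.
  rewrite -(spectral_mult_factor _ _ _ (fun a => a ^+ 2)).
  by apply: eq_spectral_mult => a b _ _; rewrite mul1r.
(* The terms with a = b vanish, so the sum may run over all of rs x rs. *)
pose r := [seq p <- allpairs pair rs rs | p.1 != p.2].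
rewrite (_ : [set p | _] = [set` r]); last first.
  apply/seteqP; split=> -[a b] /=.
    case=> aV bV ab; rewrite mem_filter ab /=.
    by apply: allpairs_f; rewrite rsE.
  rewrite mem_filter => /andP[ab /allpairsP[[c d] [/= crs drs [ac bd]]]].
  by move: ab; rewrite ac bd; split => //; apply: rs_eig.
rewrite -fsbig_seq; last first.
  by rewrite filter_uniq // allpairs_uniq // => -[a b] [c d].
rewrite big_filter big_mkcond big_allpairs; apply: eq_bigr => a _ /=.
apply: eq_bigr => b _; case: eqVneq => //= ->.
by rewrite subrr mulr0 scale0r.
Qed.

Lemma posdef_eigenvalue_gt0 (R : realType) n (V : 'M[R]_n) a :
  posdefmx V -> eigenvalue V a -> 0 < a.
Proof.
move=> [_ Vpos] /eigenvalueP[u uV u0].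
have := Vpos u^T; rewrite trmx_eq0 trmxK u0 uV => /(_ isT).
rewrite -scalemxAl mxE pmulr_lgt0 //.
by rewrite -trace_mx11 inner_gt0.
Qed.

Theorem mainTheorem1 (R : realType) (g : R -> R -> R)
    (g_antisym : forall s t : R, 0 < s -> 0 < t -> g s t = - g t s)
    (g_homog : forall s t a : R, 0 < s -> 0 < t -> 0 < a ->
       g (a * s) (a * t) = g s t)
    (V : 'M[R]_3) (V_posdef : posdefmx V)
    (lambda : 'I_3 -> R)
    (V_eig : char_poly V = \prod_(i < 3) ('X - (lambda i)%:P)) :
  ((forall D : 'M[R]_3, D \is symmetricmx -> D != 0 ->
      0 < inner (stiffness g V D) D)
   <-> (forall i j : 'I_3, 0 < zcoef g lambda i j))
  /\
  (set_bij (Sym R 3) (Sym R 3) (stiffness g V)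
   <-> (forall i j : 'I_3, zcoef g lambda i j != 0)).
Proof.
have Vt : V^T = V by apply/symmetricmxP; case: V_posdef.
pose rs := undup (codom lambda).
have rs_uniq : uniq rs by apply: undup_uniq.
have lambda_rs i : lambda i \in rs by rewrite mem_undup codom_f.
have rsE : rs =i eigenvalue V.
  move=> a; rewrite mem_undup [RHS]eigenvalue_root_char V_eig.
  rewrite -[index_enum _]enumT -(big_map lambda predT (fun r => 'X - r%:P)).
  by rewrite root_prod_XsubC.
have rs1 : \sum_(r <- rs) eigenproj V r = 1%:M.
  exact/sum_eigenproj/(symmetric_sum_eigenspace Vt V_eig).
have rs_eig : {in rs, forall a, eigenvalue V a} by move=> a; rewrite rsE.
have P0 : {in rs, forall a, eigenproj V a != 0}.
  by move=> a /rs_eig; apply: eigenproj_neq0.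
have trP := @tr_eigenproj R 3 V; have mulP := mul_eigenproj Vt.
have zC : {in rs &, forall a b, stiffness_symbol g a b = stiffness_symbol g b a}.
  move=> a b /rs_eig/(posdef_eigenvalue_gt0 V_posdef) a0.
  move=> /rs_eig/(posdef_eigenvalue_gt0 V_posdef) b0.
  by rewrite /stiffness_symbol g_antisym // mulNr -mulrN opprB [a ^+ 2 + _]addrC.
(* Repeated entries of lambda give the same coefficients, so quantifying over
   indices or over distinct eigenvalues is the same. *)
have zrs (Q : R -> Prop) : {in rs &, forall a b, Q (stiffness_symbol g a b)} <->
    forall i j, Q (zcoef g lambda i j).
  split=> [Qz i j|Qz a b]; first exact: Qz.
  by rewrite !mem_undup => /codomP[i ->] /codomP[j ->]; apply: Qz.
have -> : stiffness g V = spectral_mult (eigenproj V) rs (stiffness_symbol g).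
  by apply/funext => D; apply: stiffness_spectral.
split.
- exact: iff_trans (spectral_mult_posdef rs_uniq trP mulP rs1 P0 zC)
    (zrs (fun z => 0 < z)).
- exact: iff_trans (spectral_mult_bij rs_uniq trP mulP rs1 P0 zC)
    (zrs (fun z => z != 0)).
Qed.
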